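(* Assume that $g$ is the indicator function of a simple convex set $\mathcal{K}\subset\mathbb{R}^d$. Then the sequence $x_k$ generated by the composite conditional gradient algorithm with the approximate (multiplicative-error) linear minimization oracle described in the context, with $\delta\in(0,1]$ and with the modified parameters $\eta_k=\frac{2}{\delta(k-1)+2}$ and $\beta_k=\frac{\beta_0}{\sqrt{\delta k+1}}$, satisfies: $$f(x_k)-f^\star\;\ge\;-\|y^\star\|\,\mathrm{dist}(Ax_k,\mathcal{K}),$$ $$f(x_k)-f^\star\;\le\;\frac{2}{\delta}\left(\frac{D_{\mathcal{X}}^2L_f+\delta\mathcal{E}}{\delta k+1}+\frac{D_{\mathcal{X}}^2\|A\|^2}{\beta_0\sqrt{\delta k+1}}\right),$$ $$\mathrm{dist}(Ax_k,\mathcal{K})\;\le\;\frac{2\beta_0}{\sqrt{\delta k+1}}\left(\|y^\star\|+\sqrt{\frac{D_{\mathcal{X}}^2C_0+\delta\mathcal{E}}{\beta_0\delta}}\right),$$ where $\mathcal{E}=F(x_1)-F^\star$ and $C_0=L_f+\|A\|^2/\beta_0$.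
   Context: Problem: $\min_{x\in\mathcal{X}} F(x) := f(x)+g(Ax)$, where $\mathcal{X}\subset\mathbb{R}^n$ is nonempty, compact and convex; $f$ is a proper closed convex function, differentiable on $\mathcal{X}$ and $L_f$-smooth, i.e. $\|\nabla f(x)-\nabla f(x')\|\le L_f\|x-x'\|$ for all $x,x'\in\mathcal{X}$; $A\in\mathbb{R}^{d\times n}$; and $g:\mathbb{R}^d\to\mathbb{R}\cup\{+\infty\}$ is proper, closed, convex (so $\mathcal{K}$ is nonempty and closed). Norms of vectors are Euclidean, $\|A\|$ is the spectral norm, and $\mathrm{dist}(z,\mathcal{K})$ is the Euclidean distance from $z$ to $\mathcal{K}$. The indicator function of $\mathcal{K}$ is $0$ on $\mathcal{K}$ and $+\infty$ elsewhere; ''simple'' means that the projection onto $\mathcal{K}$ is tractable. The set of minimizers is assumed nonempty; $x^\star$ is a minimizer, $f^\star=f(x^\star)$ and $F^\star=F(x^\star)$. $D_{\mathcal{X}}=\max_{x,x'\in\mathcal{X}}\|x-x'\|$. Also $\mathrm{prox}_{\phi}(v)=\arg\min_x \phi(x)+\frac12\|x-v\|^2$; for $g$ the indicator of $\mathcal{K}$, $\mathrm{prox}_{\beta g}$ is the projection onto $\mathcal{K}$. Duality: with $g^*(y)=\sup_v\langle y,v\rangle-g(v)$ and $\mathcal{L}(x,y)=f(x)+\langle y,Ax\rangle-g^*(y)$, strong duality is assumed: $\max_{y\in\mathbb{R}^d}\min_{x\in\mathcal{X}}\mathcal{L}(x,y)=\min_{x\in\mathcal{X}}\max_{y\in\mathbb{R}^d}\mathcal{L}(x,y)$;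 $y^\star$ denotes a solution of the dual problem $\max_{y}\min_{x\in\mathcal{X}}\mathcal{L}(x,y)$. Algorithm with multiplicative-error oracle: given $x_1\in\mathcal{X}$, $\beta_0>0$, for $k=1,2,\dots$ set $\eta_k=\frac{2}{\delta(k-1)+2}$, $\beta_k=\frac{\beta_0}{\sqrt{\delta k+1}}$, $v_k=\beta_k\nabla f(x_k)+A^\top\big(Ax_k-\mathrm{prox}_{\beta_k g}(Ax_k)\big)$; the oracle returns $\tilde s_k\in\mathcal{X}$ such that $$\langle v_k,\tilde s_k-x_k\rangle\le\delta\,\langle v_k,s_k-x_k\rangle,$$ where $s_k\in\arg\min_{x\in\mathcal{X}}\langle v_k,x\rangle$ is an exact solution; set $x_{k+1}=x_k+\eta_k(\tilde s_k-x_k)$. *)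

(* Defs.v *)
From mathcomp Require Import all_boot all_order all_algebra.
From mathcomp Require Import all_classical all_reals all_analysis.

Set Implicit Arguments.
Unset Strict Implicit.
Unset Printing Implicit Defensive.

Import Order.TTheory GRing.Theory Num.Theory.
Import numFieldNormedType.Exports.

Local Open Scope classical_set_scope.
Local Open Scope ring_scope.

Definition dotv (R : realType) (m : nat) (u v : 'cV[R]_m) : R :=
  \sum_(i < m) u i 0 * v i 0.

(* The library norm `|u| on matrices is the sup norm (it induces the same
   topology), hence this separate Euclidean norm. *)
Definition eucl_norm (R : realType) (m : nat) (u : 'cV[R]_m) : R :=
  Num.sqrt (dotv u u).

Definition specnorm (R : realType) (m n : nat) (A : 'M[R]_(m, n)) : R :=
  sup [set eucl_norm (A *m z) | z in [set z : 'cV[R]_n | eucl_norm z <= 1]].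

Definition eucl_dist (R : realType) (m : nat) (z : 'cV[R]_m) (K : set 'cV[R]_m) : R :=
  inf [set eucl_norm (z - w) | w in K].

Definition eucl_diam (R : realType) (m : nat) (X : set 'cV[R]_m) : R :=
  sup [set eucl_norm (p.1 - p.2) | p in X `*` X].

Definition argmin (T : Type) (disp : Order.disp_t) (Y : porderType disp)
    (phi : T -> Y) (D : set T) : set T :=
  [set x | D x /\ forall z, D z -> (phi x <= phi z)%O].

Definition eproper (R : realType) (m : nat) (h : 'cV[R]_m -> \bar R) : Prop :=
  (forall z, -oo < h z)%E /\ exists z, h z \is a fin_num.

Definition econvex (R : realType) (m : nat) (h : 'cV[R]_m -> \bar R) : Prop :=
  forall (x y : 'cV[R]_m) (t : R), 0 <= t -> t <= 1 ->
    (h (t *: x + (1 - t) *: y)%R <= t%:E * h x + (1 - t)%:E * h y)%E.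

Definition proper_closed_convex (R : realType) (m : nat)
    (h : 'cV[R]_m -> \bar R) : Prop :=
  [/\ eproper h, lower_semicontinuous h & econvex h].

Definition indicator (R : realType) (m : nat) (K : set 'cV[R]_m)
    (z : 'cV[R]_m) : \bar R :=
  if z \in K then 0%E else +oo%E.

(* Since [fine +oo = 0], finiteness near x must be required separately. *)
Definition edifferentiable (R : realType) (m : nat)
    (h : 'cV[R]_m -> \bar R) (x : 'cV[R]_m) : Prop :=
  (\forall z \near x, h z \is a fin_num) /\ differentiable (fine \o h) x.

Definition grad (R : realType) (m : nat) (h : 'cV[R]_m -> \bar R)
    (x : 'cV[R]_m) : 'cV[R]_m :=
  \col_i 'D_(delta_mx i 0) (fine \o h) x.

Definition smooth_on (R : realType) (m : nat) (L : R) (X : set 'cV[R]_m)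
    (h : 'cV[R]_m -> \bar R) : Prop :=
  forall x x', X x -> X x' -> eucl_norm (grad h x - grad h x') <= L * eucl_norm (x - x').

(* The default value 0 of [xget] is used only if there is no minimizer. *)
Definition prox (R : realType) (m : nat) (phi : 'cV[R]_m -> \bar R)
    (v : 'cV[R]_m) : 'cV[R]_m :=
  xget 0 (argmin (fun z => (phi z + (2^-1 * eucl_norm (z - v) ^+ 2)%:E)%E) setT).

Definition fenchel_conjugate (R : realType) (m : nat) (g : 'cV[R]_m -> \bar R)
    (y : 'cV[R]_m) : \bar R :=
  ereal_sup [set ((dotv y v)%:E - g v)%E | v in setT].

Definition objective (R : realType) (n d : nat) (f : 'cV[R]_n -> \bar R)
    (g : 'cV[R]_d -> \bar R) (A : 'M[R]_(d, n)) (x : 'cV[R]_n) : \bar R :=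
  (f x + g (A *m x)%R)%E.

Definition lagrangian (R : realType) (n d : nat) (f : 'cV[R]_n -> \bar R)
    (g : 'cV[R]_d -> \bar R) (A : 'M[R]_(d, n))
    (x : 'cV[R]_n) (y : 'cV[R]_d) : \bar R :=
  (f x + (dotv y (A *m x)%R)%:E - fenchel_conjugate g y)%E.

Definition dual_fun (R : realType) (n d : nat) (f : 'cV[R]_n -> \bar R)
    (g : 'cV[R]_d -> \bar R) (A : 'M[R]_(d, n)) (X : set 'cV[R]_n)
    (y : 'cV[R]_d) : \bar R :=
  ereal_inf [set lagrangian f g A x y | x in X].

(* The inner maximum over y is a supremum: it may be +oo, not attained. *)
Definition strong_duality (R : realType) (n d : nat) (f : 'cV[R]_n -> \bar R)
    (g : 'cV[R]_d -> \bar R) (A : 'M[R]_(d, n)) (X : set 'cV[R]_n) : Prop :=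
  ereal_sup [set dual_fun f g A X y | y in setT] =
  ereal_inf [set ereal_sup [set lagrangian f g A x y | y in setT] | x in X].

Definition dual_solution (R : realType) (n d : nat) (f : 'cV[R]_n -> \bar R)
    (g : 'cV[R]_d -> \bar R) (A : 'M[R]_(d, n)) (X : set 'cV[R]_n)
    (ystar : 'cV[R]_d) : Prop :=
  forall y, (dual_fun f g A X y <= dual_fun f g A X ystar)%E.

Definition eta_ (R : realType) (delta : R) (k : nat) : R :=
  2 / (delta * (k%:R - 1) + 2).

Definition beta_ (R : realType) (beta0 delta : R) (k : nat) : R :=
  beta0 / Num.sqrt (delta * k%:R + 1).

Definition direction (R : realType) (n d : nat) (f : 'cV[R]_n -> \bar R)
    (g : 'cV[R]_d -> \bar R) (A : 'M[R]_(d, n)) (beta : R)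
    (x : 'cV[R]_n) : 'cV[R]_n :=
  beta *: grad f x
    + A^T *m (A *m x - prox (fun z => (beta%:E * g z)%E) (A *m x)).

(* Indices start at 1; the 0-th terms of the sequences are unconstrained. *)
Definition cg_multiplicative (R : realType) (n d : nat)
    (f : 'cV[R]_n -> \bar R) (g : 'cV[R]_d -> \bar R) (A : 'M[R]_(d, n))
    (X : set 'cV[R]_n) (beta0 delta : R)
    (x s stilde : nat -> 'cV[R]_n) : Prop :=
  X (x 1%N) /\
  forall k, (1 <= k)%N ->
    let v := direction f g A (beta_ beta0 delta k) (x k) in
    [/\ argmin (dotv v) X (s k),
        X (stilde k),
        dotv v (stilde k - x k) <= delta * dotv v (s k - x k) &
        x k.+1 = x k + eta_ delta k *: (stilde k - x k)].

(* Main.v *)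
Require Import Defs.
From mathcomp Require Import all_boot all_order all_algebra.
From mathcomp Require Import all_classical all_reals all_analysis.
From mathcomp Require Import ring lra.
Import Order.TTheory GRing.Theory Num.Theory.
Import numFieldNormedType.Exports.
Local Open Scope classical_set_scope.
Local Open Scope ring_scope.

(** Write [u = delta * k + 1], [w = delta * (k - 1) + 2], so that
    [eta_k = 2 / w] and [beta_k = beta0 / sqrt u], and let [p_k] be the projection
    of [A x_k] on [K]. The vector [v_k / beta_k] is the gradient at [x_k] of the
    smoothed function [F_k x = f x + dist (A x, K) ^ 2 / (2 * beta_k)]: the
    proximal point of the indicator is [p_k].

    The lower bound on [f x_k - f xstar] is weak duality. The dual value at
    [ystar] is at least the optimal value ([objective_le_dual]), and it is at most
    the Lagrangian at [(x_k, ystar)], which is at most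
    [f x_k + <ystar, A x_k - p_k>] ([dual_fun_le]); Cauchy-Schwarz concludes. The
    same two estimates show that [A xstar] lies in [K]: otherwise the dual value
    would exceed every real number.

    The upper bounds come from a descent recursion. [F_k] is smooth, with a
    constant of at most [Lf + |A| ^ 2 / beta_k], and the oracle does at least
    [delta] times as well as the direction [xstar - x_k]. Convexity of [f] and the
    obtuse angle at the projection bound the derivative in this direction, and
    give ([smoothed_descent])
      [F_k x_{k+1} - fs <= (1 - delta eta_k) (F_k x_k - fs)
         - delta eta_k dist_k ^ 2 / (2 beta_k) + eta_k ^ 2 / 2 * (M + N sqrt u)],
    where [fs = f xstar], [M = D ^ 2 Lf] and [N = D ^ 2 |A| ^ 2 / beta0]. The
    negative distance term pays for replacing [F_k x_k] by [F_{k-1} x_k] ([smoothing_step]), so the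
    gaps [T_k = F_{k-1} x_k - fs] satisfy a recursion in which they contract by
    [1 - delta eta_k]. It is solved by
      [T_k <= 2 (M + delta E) / (delta w) + 4 N / (3 delta sqrt w)]
    ([rate_step], [gap_rate]). Measuring the decay with [w] matters: the same
    induction with [u] in place of [w] breaks down for small [delta]. As [u <= w],
    the bound on [f x_k - fs] follows.

    For the distance, [T_k] involves [beta_{k-1}], which is larger than the
    [beta_k] of the claim, so that solving the quadratic inequality obtained from
    the lower bound on [f x_k - fs] is not enough. The loss is recovered from the
    a priori bound [dist_k <= |A| D], which holds because [A xstar] is in [K]
    ([feasibility_bound]); this uses the constant [4 / 3] above.

    If [A x_1] is not in [K], then [E] is infinite and so are both upper bounds. *)

(** * Euclidean geometry of column vectors *)

Lemma dotvC {R : realType} {m} (u v : 'cV[R]_m) : dotv u v = dotv v u.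
Proof. by apply: eq_bigr => i _; rewrite mulrC. Qed.

Lemma dotvDl {R : realType} {m} (u v w : 'cV[R]_m) :
  dotv (u + v) w = dotv u w + dotv v w.
Proof.
by rewrite /dotv -big_split; apply: eq_bigr => i _; rewrite mxE mulrDl.
Qed.

Lemma dotvZl {R : realType} {m} (a : R) (u v : 'cV[R]_m) :
  dotv (a *: u) v = a * dotv u v.
Proof.
by rewrite /dotv mulr_sumr; apply: eq_bigr => i _; rewrite mxE mulrA.
Qed.

Lemma dotvNl {R : realType} {m} (u v : 'cV[R]_m) : dotv (- u) v = - dotv u v.
Proof. by rewrite -scaleN1r dotvZl mulN1r. Qed.

Lemma dotvBl {R : realType} {m} (u v w : 'cV[R]_m) :
  dotv (u - v) w = dotv u w - dotv v w.
Proof. by rewrite dotvDl dotvNl. Qed.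

Lemma dotvDr {R : realType} {m} (u v w : 'cV[R]_m) :
  dotv u (v + w) = dotv u v + dotv u w.
Proof. by rewrite dotvC dotvDl !(dotvC u). Qed.

Lemma dotvZr {R : realType} {m} (a : R) (u v : 'cV[R]_m) :
  dotv u (a *: v) = a * dotv u v.
Proof. by rewrite dotvC dotvZl (dotvC u). Qed.

Lemma dotvBr {R : realType} {m} (u v w : 'cV[R]_m) :
  dotv u (v - w) = dotv u v - dotv u w.
Proof. by rewrite dotvC dotvBl !(dotvC u). Qed.

Lemma dotv_sqDZ {R : realType} {m} (u v : 'cV[R]_m) (t : R) :
  dotv (u + t *: v) (u + t *: v) = dotv u u + 2 * t * dotv u v + t ^+ 2 * dotv v v.
Proof. by rewrite !(dotvDl, dotvDr, dotvZl, dotvZr) (dotvC v u); ring. Qed.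

Lemma dotv_mulmx {R : realType} {m n} (B : 'M[R]_(m, n)) u v :
  dotv (B^T *m u) v = dotv u (B *m v).
Proof.
have dotE p (a b : 'cV[R]_p) : dotv a b = (a^T *m b) 0 0.
  by rewrite mxE; apply: eq_bigr => i _; rewrite mxE.
by rewrite !dotE trmx_mul trmxK mulmxA.
Qed.

Lemma dotvv_ge0 {R : realType} {m} (u : 'cV[R]_m) : 0 <= dotv u u.
Proof. by apply: sumr_ge0 => i _; rewrite -expr2 sqr_ge0. Qed.

Lemma dotvv_eq0 {R : realType} {m} (u : 'cV[R]_m) : dotv u u = 0 -> u = 0.
Proof.
move=> /eqP; rewrite psumr_eq0 => [/allP u0|i _]; last by rewrite -expr2 sqr_ge0.
apply/colP => i; rewrite mxE; apply/eqP.
by rewrite -sqrf_eq0 expr2; exact: (u0 i (mem_index_enum i)).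
Qed.

Lemma eucl_norm_ge0 {R : realType} {m} (u : 'cV[R]_m) : 0 <= eucl_norm u.
Proof. exact: sqrtr_ge0. Qed.

Lemma eucl_norm0 {R : realType} {m} : eucl_norm (0 : 'cV[R]_m) = 0.
Proof.
by rewrite -(scale0r 0) /eucl_norm dotvZl mul0r sqrtr0.
Qed.

Lemma eucl_norm_sq {R : realType} {m} (u : 'cV[R]_m) :
  eucl_norm u ^+ 2 = dotv u u.
Proof. by rewrite sqr_sqrtr ?dotvv_ge0. Qed.

Lemma eucl_normN {R : realType} {m} (u : 'cV[R]_m) :
  eucl_norm (- u) = eucl_norm u.
Proof. by rewrite /eucl_norm dotvNl dotvC dotvNl opprK. Qed.

Lemma eucl_distC {R : realType} {m} (u v : 'cV[R]_m) :
  eucl_norm (u - v) = eucl_norm (v - u).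
Proof. by rewrite -eucl_normN opprB. Qed.

Lemma eucl_normZ {R : realType} {m} (a : R) (u : 'cV[R]_m) :
  eucl_norm (a *: u) = `|a| * eucl_norm u.
Proof.
by rewrite /eucl_norm dotvZl dotvZr mulrA -expr2 sqrtrM ?sqr_ge0// sqrtr_sqr.
Qed.

(** The squared length of [dotv v v *: u - dotv u v *: v] is a nonnegative
    multiple of the defect in the squared inequality. *)
Lemma cauchy_schwarz {R : realType} {m} (u v : 'cV[R]_m) :
  dotv u v <= eucl_norm u * eucl_norm v.
Proof.
have [->|v0] := eqVneq v 0.
  have -> : dotv u (0 : 'cV[R]_m) = 0 by rewrite -(scale0r 0) dotvZr mul0r.
  by rewrite mulr_ge0 ?eucl_norm_ge0.
have vv : 0 < dotv v v.
  rewrite lt0r dotvv_ge0 andbT; apply: contraNneq v0 => /dotvv_eq0 ->.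
  by [].
apply: le_trans (ler_norm _) _.
rewrite -sqrtrM ?dotvv_ge0// -sqrtr_sqr ler_wsqrtr//.
have := dotvv_ge0 (dotv v v *: u - dotv u v *: v).
rewrite !(dotvBl, dotvBr, dotvZl, dotvZr) (dotvC v u).
set a := dotv u u; set b := dotv v v in vv *; set c := dotv u v => h.
have : 0 <= b * (a * b - c ^+ 2) by apply: le_trans h _; lra.
by rewrite pmulr_rge0// subr_ge0.
Qed.

(** The supremum defining [specnorm B] is meaningful because Cauchy-Schwarz on
    each row of [B] bounds the image of the unit ball. *)
Lemma specnorm_has_ubound {R : realType} {m n} (B : 'M[R]_(m, n)) :
  has_ubound [set eucl_norm (B *m z) | z in [set z : 'cV[R]_n | eucl_norm z <= 1]].
Proof.
exists (Num.sqrt (\sum_i eucl_norm (row i B)^T ^+ 2)) => _ /= [z z1 <-].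
rewrite ler_wsqrtr//; apply: ler_sum => i _.
have -> : (B *m z) i 0 = dotv (row i B)^T z.
  by rewrite mxE; apply: eq_bigr => j _; rewrite !mxE.
have h : `|dotv (row i B)^T z| <= eucl_norm (row i B)^T * eucl_norm z.
  rewrite ler_norml cauchy_schwarz andbT lerNl -dotvNl -(eucl_normN (row i B)^T).
  exact: cauchy_schwarz.
rewrite -expr2 -real_normK ?num_real// lerXn2r ?nnegrE ?eucl_norm_ge0//.
by apply: le_trans h _; rewrite ler_piMr ?eucl_norm_ge0.
Qed.

Lemma le_specnorm {R : realType} {m n} (B : 'M[R]_(m, n)) z :
  eucl_norm (B *m z) <= specnorm B * eucl_norm z.
Proof.
have [->|z0] := eqVneq z 0.
  by rewrite mulmx0 !eucl_norm0 mulr0.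
have nz : 0 < eucl_norm z.
  rewrite lt0r eucl_norm_ge0 andbT; apply: contraNneq z0 => h.
  by apply/eqP/dotvv_eq0; rewrite -eucl_norm_sq h expr0n.
rewrite -ler_pdivrMr//.
have -> : eucl_norm (B *m z) / eucl_norm z
    = eucl_norm (B *m ((eucl_norm z)^-1 *: z)).
  by rewrite -scalemxAr eucl_normZ mulrC gtr0_norm ?invr_gt0.
apply: ub_le_sup; first exact: specnorm_has_ubound.
exists ((eucl_norm z)^-1 *: z) => //=.
by rewrite eucl_normZ gtr0_norm ?invr_gt0// mulVf ?gt_eqF.
Qed.

Lemma specnorm_ge0 {R : realType} {m n} (B : 'M[R]_(m, n)) : 0 <= specnorm B.
Proof.
apply: le_trans (eucl_norm_ge0 (B *m 0)) _.
apply: ub_le_sup; first exact: specnorm_has_ubound.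
by exists 0 => //=; rewrite eucl_norm0.
Qed.

Lemma entry_le_norm {R : realType} {m} (u : 'cV[R]_m) i : `|u i 0| <= `|u|.
Proof.
rewrite [leRHS]/Num.norm /= mx_normrE.
by apply: le_trans (le_bigmax _ _ (i, ord0)).
Qed.

Lemma eucl_norm_le_norm {R : realType} {m} (u : 'cV[R]_m) :
  eucl_norm u <= Num.sqrt m%:R * `|u|.
Proof.
rewrite -[`|u|]normr_id -sqrtr_sqr -sqrtrM ?ler0n// ler_wsqrtr//.
apply: le_trans (_ : \sum_(i < m) `|u| ^+ 2 <= _).
  apply: ler_sum => i _; rewrite -expr2 -[u i 0 ^+ 2]real_normK ?num_real//.
  by rewrite lerXn2r ?nnegrE ?entry_le_norm.
by rewrite sumr_const card_ord mulr_natl.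
Qed.

Lemma eucl_diam_has_ubound {R : realType} {m} (X : set 'cV[R]_m) :
  compact X -> has_ubound [set eucl_norm (p.1 - p.2) | p in X `*` X].
Proof.
move=> /compact_bounded[M [_ /(_ (M + 1))]]; rewrite ltrDl => /(_ ltr01) XM.
exists (Num.sqrt m%:R * ((M + 1) + (M + 1))) => _ /= [[p q] /= [Xp Xq] <-].
apply: le_trans (eucl_norm_le_norm _) _; rewrite ler_wpM2l ?sqrtr_ge0//.
by apply: le_trans (ler_normB _ _) _; rewrite lerD ?XM.
Qed.

Lemma le_eucl_diam {R : realType} {m} (X : set 'cV[R]_m) p q :
  compact X -> X p -> X q -> eucl_norm (p - q) <= eucl_diam X.
Proof.
move=> cX Xp Xq; apply: ub_le_sup; first exact: eucl_diam_has_ubound.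
by exists (p, q).
Qed.

(** * Projection on a closed convex set *)

Lemma convex_segment {R : realType} {m} (X : set 'cV[R]_m) x y (t : R) :
  @convex_set R 'cV[R]_m X -> X x -> X y -> 0 <= t -> t <= 1 ->
  X (x + t *: (y - x)).
Proof.
move=> cX Xx Xy t0 t1.
have := cX y x (Itv01 t0 t1) (mem_set Xy) (mem_set Xx).
rewrite inE; congr X; rewrite /conv /= scalerBl scale1r scalerBr.
by rewrite addrCA.
Qed.

(** Compactness of closed bounded sets, applied through transposition to row
    vectors, gives a minimizer among the points no farther from [z] than [w0]. *)
Lemma exists_nearest {R : realType} {m} (K : set 'cV[R]_m) z :
  closed K -> K !=set0 ->
  exists2 p, K p & forall w, K w -> eucl_norm (z - p) <= eucl_norm (z - w).
Proof.
move=> clK [w0 Kw0].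
pose phi (v : 'rV[R]_m) : R := dotv (z - v^T) (z - v^T).
have phi_cont : continuous phi.
  have entry_cont i : continuous (fun v : 'rV[R]_m => z i 0 - v 0 i : R).
    move=> v; apply: (@continuousB R R^o _ (cst (z i 0)) (fun v : 'rV[R]_m => v 0 i : R) v).
      exact: cst_continuous.
    exact: coord_continuous.
  rewrite [phi](_ : _ =
    fun v : 'rV[R]_m => \sum_(i < m) (z i 0 - v 0 i) * (z i 0 - v 0 i)); last first.
    by apply/funext => v; apply: eq_bigr => i _; rewrite !mxE.
  have sq_cont i : true ->
      continuous (fun v : 'rV[R]_m => (z i 0 - v 0 i) * (z i 0 - v 0 i)).
    by move=> _ v; exact: continuousM (entry_cont i v) (entry_cont i v).
  exact: (continuous_big (@add_continuous R) sq_cont).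
have tr_cont : continuous (fun v : 'rV[R]_m => v^T).
  move=> v U /nbhs_ballP[e /= e0 vU]; apply/nbhs_ballP; exists e => // u [_ vu].
  by apply: vU; split => // i j; rewrite !mxE; exact: vu.
pose S := [set v : 'rV[R]_m | K v^T] `&` [set v | phi v <= phi w0^T].
have Scl : closed S.
  apply: closedI.
    by apply: (@closed_comp _ _ (fun v : 'rV[R]_m => v^T)) => // v _; exact: tr_cont.
  exact: (closed_comp (fun v _ => phi_cont v) (@closed_le R (phi w0^T))).
have Sbnd : bounded_set S.
  exists (Num.sqrt (phi w0^T) + `|z|); split; first exact: num_real.
  move=> M hM v [_ /= hv]; apply: le_trans (ltW hM).
  rewrite [leLHS]/Num.norm /= mx_normrE.
  apply/bigmax_leP; split => [|[i j] _ /=]; first by rewrite addr_ge0 ?sqrtr_ge0.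
  rewrite ord1 -[v 0 j](subKr (z j 0)) [leRHS]addrC.
  apply: le_trans (ler_normB _ _) _; rewrite lerD ?entry_le_norm//.
  rewrite -sqrtr_sqr ler_wsqrtr//; apply: le_trans hv.
  rewrite /phi /dotv (bigD1 j)//= !mxE expr2 lerDl.
  by apply: sumr_ge0 => k _; rewrite -expr2 sqr_ge0.
have S0 : S !=set0 by exists w0^T; split; rewrite /= ?trmxK.
have [v] := compact_EVT_min S0 (bounded_closed_compact Sbnd Scl)
  (continuous_subspaceT phi_cont).
rewrite inE => -[/= Kv vw0] vmin; exists v^T => // w Kw; apply: ler_wsqrtr.
have [ww0|/ltW w0w] := leP (phi w^T) (phi w0^T).
  by have := vmin w^T; rewrite inE /phi trmxK; apply; split; rewrite /= ?trmxK.
by move: (le_trans vw0 w0w); rewrite /phi trmxK.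
Qed.

(** Moving from [p] towards [w] by a small fraction of the segment decreases the
    distance to [z] when the angle at [p] is acute. *)
Lemma nearest_obtuse {R : realType} {m} (K : set 'cV[R]_m) z p w :
  @convex_set R 'cV[R]_m K -> K p ->
  (forall w, K w -> eucl_norm (z - p) <= eucl_norm (z - w)) -> K w ->
  dotv (z - p) (w - p) <= 0.
Proof.
move=> cK Kp pmin Kw; set a := dotv _ _; rewrite leNgt; apply/negP => a0.
pose b := dotv (w - p) (w - p); have b0 : 0 <= b := dotvv_ge0 _.
(* [t <= 1] keeps the point on the segment, and [t * b <= a] makes the
   first-order decrease dominate *)
pose t := a / (a + b).
have t0 : 0 < t by rewrite divr_gt0// ltr_wpDr.
have t1 : t <= 1 by rewrite ler_pdivrMr ?ltr_wpDr// mul1r lerDl.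
have := pmin _ (convex_segment K p w t cK Kp Kw (ltW t0) t1).
rewrite -(@ler_pXn2r _ 2) ?nnegrE ?eucl_norm_ge0// !eucl_norm_sq opprD addrA.
rewrite -scaleNr dotv_sqDZ -/a -/b => h.
have tb : t * b <= a.
  by rewrite mulrAC ler_pdivrMr ?ltr_wpDr// (ler_wpM2l (ltW a0))// lerDr ltW.
have : 0 < t * a by rewrite mulr_gt0.
have : t * (t * b) <= t * a by rewrite (ler_wpM2l (ltW t0)).
lra.
Qed.

Lemma dist_nearest {R : realType} {m} (K : set 'cV[R]_m) z p :
  K p -> (forall w, K w -> eucl_norm (z - p) <= eucl_norm (z - w)) ->
  eucl_dist z K = eucl_norm (z - p).
Proof.
move=> Kp pmin; apply/eqP; rewrite eq_le; apply/andP; split.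
  apply: ge_inf; last by exists p.
  by exists 0 => _ /= [w _ <-]; exact: eucl_norm_ge0.
apply: lb_le_inf; first by exists (eucl_norm (z - p)), p.
by move=> _ /= [w Kw <-]; exact: pmin.
Qed.

(** The minimization defining [prox] has a solution by [exists_nearest], and its
    objective is infinite off [K]. *)
Lemma prox_indicator {R : realType} {m} (K : set 'cV[R]_m) (beta : R) z :
  closed K -> K !=set0 -> 0 < beta ->
  let p := prox (fun z => (beta%:E * indicator K z)%E) z in
  K p /\ forall w, K w -> eucl_norm (z - p) <= eucl_norm (z - w).
Proof.
move=> clK K0 b0.
have [q Kq qmin] := exists_nearest K z clK K0.
set phi := fun w => ((beta%:E * indicator K w)%E
  + (2^-1 * eucl_norm (w - z) ^+ 2)%:E)%E.
have phiK w : K w -> phi w = (2^-1 * eucl_norm (w - z) ^+ 2)%:E.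
  by move=> Kw; rewrite /phi /indicator mem_set// mule0 add0e.
have phiN w : ~ K w -> phi w = +oo%E.
  by move=> Kw; rewrite /phi /indicator memNset// gt0_muley ?lte_fin.
have sq_mono (u w : 'cV[R]_m) :
    (2^-1 * eucl_norm (u - z) ^+ 2 <= 2^-1 * eucl_norm (w - z) ^+ 2)
    = (eucl_norm (z - u) <= eucl_norm (z - w)).
  rewrite ler_pM2l ?invr_gt0// !(eucl_distC z).
  by rewrite ler_pXn2r ?nnegrE ?eucl_norm_ge0.
have [] : argmin phi setT (prox (fun z => (beta%:E * indicator K z)%E) z).
  apply: xgetPex; exists q; split => // w _.
  change (phi q <= phi w)%E.
  have [Kw|/phiN ->] := pselect (K w); last by rewrite leey.
  by rewrite !phiK// lee_fin sq_mono qmin.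
move=> _ pmin p; have Kp : K p.
  apply: contrapT => /phiN h; have := pmin q I.
  by rewrite -/p h phiK// leye_eq.
split => // w Kw; have := pmin w I.
by rewrite -/p !phiK// lee_fin sq_mono.
Qed.

Lemma indicator_closed {R : realType} {m} (K : set 'cV[R]_m) :
  lower_semicontinuous (indicator K) -> closed K.
Proof.
move=> /lower_semicontinuousP /(_ 0) oC.
rewrite -openC; congr (open _) : oC; apply/seteqP; split => z /=.
  by rewrite /indicator; case: ifPn => [_|/negP]; rewrite ?ltxx// inE.
by move=> Kz; rewrite /indicator memNset// ltry.
Qed.

(** * First-order estimates along segments *)

Lemma dotv_grad {R : realType} {n} (f : 'cV[R]_n -> \bar R) (x v : 'cV[R]_n) :
  differentiable (fine \o f) x -> dotv (grad f x) v = 'D_v (fine \o f) x.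
Proof.
move=> df; have -> : v = \sum_(i < n) v i 0 *: delta_mx i 0.
  apply/colP => j; rewrite summxE (bigD1 j)//= big1 => [|i ij].
    by rewrite !mxE !eqxx mulr1 addr0.
  by rewrite !mxE eq_sym (negPf ij) mulr0.
rewrite deriveE// linear_sum /dotv; apply: eq_bigr => i _.
rewrite linearZ summxE (bigD1 i)//= big1 => [|j ji].
  by rewrite !mxE !eqxx mulr1 addr0 deriveE// mulrC.
by rewrite !mxE eq_sym (negPf ji) mulr0.
Qed.

Lemma is_derive_line {R : realType} {n} (f : 'cV[R]_n -> \bar R) (x v : 'cV[R]_n)
    (t : R) :
  differentiable (fine \o f) (x + t *: v) ->
  is_derive t 1 (fun s : R => fine (f (x + s *: v))) (dotv (grad f (x + t *: v)) v).
Proof.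
move=> df; have /derivableP[dv dE] := diff_derivable (v := v) df.
have quotE : (fun h : R => h^-1 *: (((fun s : R => fine (f (x + s *: v))) \o shift t)
      (h *: 1) - fine (f (x + t *: v))))
   = (fun h : R => h^-1 *: (((fine \o f) \o shift (x + t *: v)) (h *: v)
      - (fine \o f) (x + t *: v))).
  apply/funext => h /=; congr (_ *: (fine (f _) - _)).
  by rewrite scaler1 scalerDl addrCA.
apply: DeriveDef; first by rewrite /derivable quotE.
by rewrite /derive quotE dotv_grad.
Qed.

(** The upper quadratic bound given by a Lipschitz gradient: the gap between the
    two sides is monotone along the segment, because its derivative is
    controlled by Cauchy-Schwarz. *)
Lemma descent_lemma {R : realType} {n} (f : 'cV[R]_n -> \bar R) (L : R)
    (X : set 'cV[R]_n) (x y : 'cV[R]_n) :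
  @convex_set R 'cV[R]_n X ->
  (forall z, X z -> differentiable (fine \o f) z) -> smooth_on L X f ->
  X x -> X y ->
  fine (f y) <= fine (f x) + dotv (grad f x) (y - x)
                + L / 2 * eucl_norm (y - x) ^+ 2.
Proof.
move=> cX df fL Xx Xy; set v : 'cV[R]_n := y - x; set c := eucl_norm v ^+ 2.
pose a := dotv (grad f x) v.
pose h (t : R) := fine (f (x + t *: v)).
pose psi : R -> R := h - (fun t => a * t + (L * c / 2) * t ^+ 2).
have Xseg (t : R) : 0 <= t -> t <= 1 -> X (x + t *: v) by exact: convex_segment.
have dpsi (t : R) : 0 <= t -> t <= 1 ->
    is_derive t 1 psi (dotv (grad f (x + t *: v)) v - (a + L * c * t)).
  move=> t0 t1; apply: is_deriveB; first exact/is_derive_line/df/Xseg.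
  by apply: is_derive_eq; rewrite /GRing.scale /=; field.
have : psi 1 <= psi 0.
  apply: (@ler0_derive1_nincr _ psi 0 1) => // [t|t|].
  - by rewrite in_itv /= => /andP[/ltW t0 /ltW t1]; have [] := dpsi t t0 t1.
  - rewrite in_itv /= => /andP[/ltW t0 /ltW t1].
    have [_ dE] := dpsi t t0 t1; rewrite derive1E dE opprD addrA -dotvBl subr_le0.
    apply: le_trans (cauchy_schwarz _ _) _.
    apply: le_trans (ler_wpM2r (eucl_norm_ge0 _) (fL _ _ (Xseg _ t0 t1) Xx)) _.
    rewrite addrC addKr eucl_normZ ger0_norm// /c; lra.
  - apply: derivable_within_continuous => t.
    by rewrite in_itv /= => /andP[t0 t1]; have [] := dpsi t t0 t1.
rewrite /psi !fctE /h scale1r scale0r addr0 -/a [x + v]addrC subrK; lra.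
Qed.

(** A first-order gap would persist in the difference quotients at small [s > 0],
    which convexity bounds by [f y - f x]. *)
Lemma convex_gradient {R : realType} {n} (f : 'cV[R]_n -> \bar R) (x y : 'cV[R]_n) :
  econvex f -> differentiable (fine \o f) x -> (forall z, -oo < f z)%E ->
  f x \is a fin_num -> f y \is a fin_num ->
  fine (f x) + dotv (grad f x) (y - x) <= fine (f y).
Proof.
move=> cf df fNy fx fy; rewrite -lerBrDl leNgt; apply/negP => gap.
have df0 : differentiable (fine \o f) (x + 0 *: (y - x)) by rewrite scale0r addr0.
have [dh hE] := is_derive_line _ _ _ _ df0.
rewrite scale0r addr0 in hE.
have : \forall s \near 0^', fine (f y) - fine (f x) <
   s^-1 *: (((fun s : R => fine (f (x + s *: (y - x)))) \o shift 0) (s *: 1)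
            - fine (f (x + 0 *: (y - x)))).
  by apply: (cvgr_gt _ dh); rewrite -/(derive _ _ _) hE.
move=> /nbhs_ballP[e /= e0 he].
pose s := Num.min (e / 2) 1.
have s0 : 0 < s by rewrite lt_min ltr01 divr_gt0.
have s1 : s <= 1 by rewrite ge_min lexx orbT.
have /he : ball (0 : R) e s.
  rewrite -ball_normE /= sub0r normrN gtr0_norm// gt_min; apply/orP; left; lra.
move=> /(_ (lt0r_neq0 s0)) /=.
rewrite scale0r !addr0 scaler1 /GRing.scale /= ltr_pdivlMl//.
have := cf y x s (ltW s0) s1.
have -> : s *: y + (1 - s) *: x = x + s *: (y - x).
  by rewrite scalerBl scalerBr scale1r addrCA.
rewrite -(fineK fx) -(fineK fy) -!EFinM -EFinD.
case E : (f (x + s *: (y - x))) => [r| |]; rewrite ?lee_fin//=.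
- lra.
- by have := fNy (x + s *: (y - x)); rewrite E.
Qed.

(** * The scalar recursion *)

(** Here [r / beta0] and [q / beta0] are the inverses of two consecutive smoothing
    parameters. Divided by [w = u + 1 - delta], the inequality says that
    [(1 - 2 delta eta) / beta_k <= (1 - delta eta) / beta_{k-1}]. *)
Lemma smoothing_step {R : realType} (delta u r q : R) :
  0 < delta -> delta <= 1 -> 1 + delta <= u -> 0 <= r -> 0 <= q ->
  r ^+ 2 = u -> q ^+ 2 = u - delta ->
  (u + 1 - 5 * delta) * r <= (u + 1 - 3 * delta) * q.
Proof.
move=> d0 d1 u1 r0 q0 rE qE.
have u0 : 0 < u by lra.
have qr : q <= r by rewrite -(@ler_pXn2r _ 2) ?nnegrE// rE qE; lra.
(* sqrt(1 - t) >= 1 - t at t = delta / u *)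
have sq : (u - delta) * r <= u * q.
  have : 0 <= (q * r) * (r - q) by rewrite mulr_ge0 ?mulr_ge0 ?subr_ge0.
  rewrite -qE -rE; lra.
rewrite -(ler_pM2l u0).
have h1 : 0 <= (u + 1 - 3 * delta) * (u * q - (u - delta) * r).
  by rewrite mulr_ge0 ?subr_ge0//; lra.
have h2 : 0 <= delta * (u - 1 + 3 * delta) * r.
  by rewrite !mulr_ge0//; lra.
lra.
Qed.

(** The estimate of the smoothed gap, at [w = delta * (k - 1) + 2]. The
    constants [2] and [4 / 3] are chosen so that [rate_step] holds. *)
Definition rate {R : realType} (delta P N w : R) : R :=
  2 * P / (delta * w) + 4 * N / (3 * delta * Num.sqrt w).

(** The recursion is linear in [P] and [N], so the two decays are checked
    separately: the first on rational functions of [w], the second after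
    squaring away the square roots. *)
Lemma rate_step {R : realType} (delta P N M w r : R) :
  0 < delta -> delta <= 1 -> 2 <= w -> 0 <= N -> M <= P -> 0 <= P ->
  r <= Num.sqrt w ->
  (1 - delta * (2 / w)) * rate delta P N w + (2 / w) ^+ 2 / 2 * (M + N * r)
    <= rate delta P N (w + delta).
Proof.
move=> d0 d1 w2 N0 MP P0; rewrite /rate.
have w0 : 0 < w by lra.
have m0 : 0 < Num.sqrt w by rewrite sqrtr_gt0.
have mE : Num.sqrt w ^+ 2 = w by rewrite sqr_sqrtr ?ltW.
have m'0 : 0 < Num.sqrt (w + delta) by rewrite sqrtr_gt0; lra.
have m'E : Num.sqrt (w + delta) ^+ 2 = w + delta by rewrite sqr_sqrtr; lra.
set m := Num.sqrt w in m0 mE *; set m' := Num.sqrt _ in m'0 m'E * => rm.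
have Ppart : (1 - delta * (2 / w)) * (2 / (delta * w)) + (2 / w) ^+ 2 / 2
    <= 2 / (delta * (w + delta)).
  rewrite -subr_ge0.
  have -> : 2 / (delta * (w + delta)) -
     ((1 - delta * (2 / w)) * (2 / (delta * w)) + (2 / w) ^+ 2 / 2) =
     2 * delta / (w ^+ 2 * (w + delta)).
    by field; apply/and3P; split; lra.
  by rewrite divr_ge0 ?mulr_ge0 ?exprn_ge0//; lra.
have mm' : (w - delta / 2) * m' <= w * m.
  rewrite -(@ler_pXn2r _ 2) ?nnegrE ?mulr_ge0//; try lra.
  rewrite !exprMn mE m'E -subr_ge0.
  have -> : w ^+ 2 * w - (w - delta / 2) ^+ 2 * (w + delta)
     = delta ^+ 2 * ((3 * w - delta) / 4) by field.
  by rewrite mulr_ge0 ?sqr_ge0//; lra.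
have Npart : (1 - delta * (2 / w)) * (4 / (3 * delta * m)) + (2 / w) ^+ 2 / 2 * m
    <= 4 / (3 * delta * m').
  rewrite -subr_ge0.
  have -> : 4 / (3 * delta * m') -
     ((1 - delta * (2 / w)) * (4 / (3 * delta * m)) + (2 / w) ^+ 2 / 2 * m) =
     4 / (3 * delta * m * m' * w) * (w * m - (w - delta / 2) * m').
    by rewrite -mE; field; apply/and3P; split; lra.
  rewrite mulr_ge0 ?subr_ge0// divr_ge0 ?mulr_ge0//; lra.
have c0 : 0 <= (2 / w) ^+ 2 / 2 by rewrite divr_ge0 ?sqr_ge0.
have hM : (2 / w) ^+ 2 / 2 * M <= (2 / w) ^+ 2 / 2 * P by rewrite ler_wpM2l.
have hN : (2 / w) ^+ 2 / 2 * (N * r) <= (2 / w) ^+ 2 / 2 * (N * m).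
  by rewrite !ler_wpM2l.
have := ler_wpM2r P0 Ppart; have := ler_wpM2r N0 Npart.
have coef (a b c : R) : a * b / c = a / c * b by rewrite mulrAC.
rewrite !(coef 2) !(coef 4); move: hM hN.
move: (2 / (delta * w)) (2 / (delta * (w + delta))) (4 / (3 * delta * m))
  (4 / (3 * delta * m')) (1 - delta * (2 / w)) ((2 / w) ^+ 2 / 2) => *.
lra.
Qed.

Lemma rate_anti {R : realType} (delta P N u w : R) :
  0 < delta -> 0 < u -> u <= w -> 0 <= P -> 0 <= N ->
  rate delta P N w <= 2 / delta * (P / u + N / Num.sqrt u).
Proof.
move=> d0 u0 uw P0 N0; have w0 : 0 < w by lra.
have ru : 0 < Num.sqrt u by rewrite sqrtr_gt0.
have rw : Num.sqrt u <= Num.sqrt w by exact: ler_wsqrtr.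
have -> : rate delta P N w = 2 / delta * (P / w + 2 / 3 * (N / Num.sqrt w)).
  by rewrite /rate; field; rewrite ?gt_eqF ?(lt_le_trans ru rw).
have c0 : 0 <= 2 / delta by rewrite divr_ge0 ?ltW.
rewrite (ler_wpM2l c0)// lerD//; first by rewrite ler_wpM2l// lef_pV2.
apply: le_trans (_ : N / Num.sqrt w <= _).
  have : 0 <= N / Num.sqrt w by rewrite divr_ge0 ?sqrtr_ge0.
  lra.
by rewrite ler_wpM2l// lef_pV2 ?posrE// (lt_le_trans ru rw).
Qed.

(** The square roots [r] of [u] and [q] of [u - delta] belong to the smoothing
    parameters [beta0 / r] of the conclusion and [beta0 / q] of the hypothesis.
    If the conclusion failed, [Y * d] would be less than
    [d ^ 2 * r / (2 * beta0) - S * d]. In the hypothesis on [a] the quadratic terms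
    then leave only [d ^ 2 * (r - q) / (2 * beta0)], which is at most [S * d / 4]
    because [d <= G <= beta0 * S] and [r - q <= 1 / 2]. What remains is
    [3 / 4 * (S * d) < rate], whereas [S * d >= 2 * beta0 * S ^ 2 / r] and
    [rate <= 3 / 2 * beta0 * S ^ 2 / r]. *)
Lemma feasibility_bound {R : realType} (beta0 delta u w q d Y G P a S : R) :
  0 < beta0 -> 0 < delta -> delta <= 1 -> 2 <= w -> u <= w ->
  1 + delta <= u -> 0 <= q -> q ^+ 2 = u - delta ->
  0 <= d -> 0 <= Y -> 0 <= P -> d <= G -> - Y * d <= a ->
  a + d ^+ 2 * q / (2 * beta0) <= rate delta P (G ^+ 2 / beta0) w ->
  0 <= S -> S ^+ 2 = (P + G ^+ 2 / beta0) / (beta0 * delta) ->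
  d <= 2 * beta0 / Num.sqrt u * (Y + S).
Proof.
move=> b0 d0 d1 w2 uw u1 q0 qE dd0 Y0 P0 dG aY aR S0 SE.
set N := G ^+ 2 / beta0 in aR SE *.
have u0 : 0 < u by lra.
have N0 : 0 <= N by rewrite divr_ge0 ?sqr_ge0 ?ltW.
have r0 : 0 < Num.sqrt u by rewrite sqrtr_gt0.
have rE : Num.sqrt u ^+ 2 = u by rewrite sqr_sqrtr ?ltW.
have rm : Num.sqrt u <= Num.sqrt w by exact: ler_wsqrtr.
set r := Num.sqrt u in r0 rE rm *.
rewrite mulrAC ler_pdivlMr// [d * r]mulrC leNgt; apply/negP => far.
have d_gt0 : 0 < d.
  rewrite -(pmulr_rgt0 _ r0); apply: le_lt_trans far.
  by rewrite mulr_ge0 ?addr_ge0// mulr_ge0 ?(ltW b0).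
have S2 : S ^+ 2 * (beta0 * delta) = P + N by rewrite SE divfK// gt_eqF ?mulr_gt0.
have G0 := le_trans dd0 dG.
have dS : d <= beta0 * S.
  apply: le_trans dG _; rewrite -(@ler_pXn2r _ 2) ?nnegrE ?mulr_ge0 ?(ltW b0) //.
  have -> : G ^+ 2 = beta0 * N by rewrite /N mulrC divfK ?gt_eqF.
  rewrite exprMn expr2 -mulrA ler_pM2l//.
  have : beta0 * S ^+ 2 * delta <= beta0 * S ^+ 2.
    by rewrite ler_piMr// mulr_ge0 ?sqr_ge0 ?(ltW b0).
  lra.
have q1 : 1 <= q by rewrite -(@ler_pXn2r _ 2) ?nnegrE// qE expr1n; lra.
have qr : q <= r by rewrite -(@ler_pXn2r _ 2) ?nnegrE ?(ltW r0)// qE rE; lra.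
have gap : r - q <= 2^-1.
  have : 2 * (r - q) <= (r + q) * (r - q) by rewrite ler_wpM2r ?subr_ge0//; lra.
  have -> : (r + q) * (r - q) = delta by rewrite mulrC -subr_sqr rE qE; lra.
  lra.
(* the negated conclusion turns the lower bound on [a] into an upper bound on
   [S * d] *)
have Sd : d ^+ 2 * q / (2 * beta0) + S * d < rate delta P N w
    + d ^+ 2 * r / (2 * beta0).
  have : (Y + S) * d < r * d / (2 * beta0) * d.
    by rewrite ltr_pM2r// ltr_pdivlMr ?mulr_gt0// mulrC.
  have -> : r * d / (2 * beta0) * d = d ^+ 2 * r / (2 * beta0).
    by field; rewrite gt_eqF.
  lra.
have Sd4 : d ^+ 2 * r / (2 * beta0) - d ^+ 2 * q / (2 * beta0) <= S * d / 4.
  have -> : d ^+ 2 * r / (2 * beta0) - d ^+ 2 * q / (2 * beta0)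
      = d * (d * (r - q)) / (2 * beta0) by field; rewrite gt_eqF.
  rewrite ler_pdivrMr ?mulr_gt0//.
  have -> : S * d / 4 * (2 * beta0) = d * (beta0 * S * 2^-1) by field.
  rewrite ler_pM2l//; by apply: ler_pM => //; rewrite subr_ge0.
have SSd : 2 * beta0 * S ^+ 2 <= r * (S * d).
  have : 0 <= S * (r * d - 2 * beta0 * (Y + S)) by rewrite mulr_ge0// subr_ge0 ltW.
  have : 0 <= S * (beta0 * Y) by rewrite !mulr_ge0// ltW.
  lra.
(* [2 / sqrt w] and [4 / 3] are both at most [3 / 2] *)
have rateE : r * rate delta P N w <= 3 / 2 * (beta0 * S ^+ 2).
  have m0 : 0 < Num.sqrt w := lt_le_trans r0 rm.
  have -> : beta0 * S ^+ 2 = P / delta + N / delta.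
    rewrite -mulrDl -S2; field; exact: lt0r_neq0.
  have mE : Num.sqrt w ^+ 2 = w by rewrite sqr_sqrtr; lra.
  have m43 : 4 / 3 <= Num.sqrt w.
    by rewrite -(@ler_pXn2r _ 2) ?nnegrE ?sqrtr_ge0// mE; lra.
  have -> : r * rate delta P N w
     = P / delta * (r / Num.sqrt w * (2 / Num.sqrt w))
       + N / delta * (r / Num.sqrt w * (4 / 3)).
    by rewrite /rate -{1}mE; field; rewrite ?gt_eqF.
  have rm1 : r / Num.sqrt w <= 1 by rewrite ler_pdivrMr// mul1r.
  have rm0 : 0 <= r / Num.sqrt w by rewrite divr_ge0 ?ltW.
  rewrite mulrDr; apply: lerD; rewrite [leRHS]mulrC.
    rewrite ler_wpM2l ?divr_ge0 ?(ltW d0)// -[leRHS]mul1r.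
    apply: ler_pM => //.
    by rewrite ler_pdivrMr//; lra.
  apply: ler_wpM2l; first exact: divr_ge0 N0 (ltW d0).
  lra.
have : r * (3 / 4 * (S * d)) < r * rate delta P N w by rewrite ltr_pM2l//; lra.
lra.
Qed.

(** * Descent of the smoothed gap *)

(** When [L < 0] the Lipschitz condition forces [X] to be a single point. *)
Lemma smooth_diam {R : realType} {n} (f : 'cV[R]_n -> \bar R) (L : R)
    (X : set 'cV[R]_n) p q :
  compact X -> smooth_on L X f -> X p -> X q ->
  L * eucl_norm (p - q) ^+ 2 <= eucl_diam X ^+ 2 * L.
Proof.
move=> cX fL Xp Xq; have pqD := le_eucl_diam X p q cX Xp Xq.
have D0 : 0 <= eucl_diam X := le_trans (eucl_norm_ge0 _) pqD.
have [L0|L0] := leP 0 L.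
  by rewrite mulrC ler_wpM2r// ler_pXn2r ?nnegrE ?eucl_norm_ge0.
have single u v : X u -> X v -> eucl_norm (u - v) = 0.
  move=> Xu Xv; apply/eqP; rewrite eq_le eucl_norm_ge0 andbT.
  rewrite -(ler_nM2l L0) mulr0; exact: le_trans (eucl_norm_ge0 _) (fL _ _ Xu Xv).
suff -> : eucl_diam X = 0 by rewrite single// expr0n mulr0 mul0r.
apply/eqP; rewrite eq_le D0 andbT; apply: ge_sup.
  by exists (eucl_norm (p - q)), (p, q).
by move=> _ /= [[u v] /= [Xu Xv] <-]; rewrite single.
Qed.

Lemma dotv_direction {R : realType} {n d} (f : 'cV[R]_n -> \bar R)
    (g : 'cV[R]_d -> \bar R) (A : 'M[R]_(d, n)) (beta : R) x z :
  dotv (direction f g A beta x) z = beta * dotv (grad f x) z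
    + dotv (A *m x - prox (fun w => (beta%:E * g w)%E) (A *m x)) (A *m z).
Proof. by rewrite /direction dotvDl dotvZl dotv_mulmx. Qed.

(** One step, for the function [f + dist(A x, K) ^ 2 / (2 * beta)] of gradient
    [direction f (indicator K) A beta x / beta]. The distance at the new point
    is bounded by the distance to the old projection [p]: the function
    [|A z - p| ^ 2] of [z] is an upper bound of the squared distance, tangent to
    it at [x], and it is quadratic. *)
Lemma smoothed_descent {R : realType} {n d} (f : 'cV[R]_n -> \bar R)
    (L : R) (X : set 'cV[R]_n) (A : 'M[R]_(d, n)) (K : set 'cV[R]_d)
    (beta delta eta : R) (x s t x' xs : 'cV[R]_n) :
  compact X -> @convex_set R 'cV[R]_n X -> econvex f -> (forall z, -oo < f z)%E ->
  (forall z, X z -> edifferentiable f z) -> smooth_on L X f ->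
  closed K -> @convex_set R 'cV[R]_d K ->
  0 < beta -> 0 < delta -> 0 <= eta -> eta <= 1 ->
  X x -> X t -> X xs -> K (A *m xs) ->
  let v := direction f (indicator K) A beta x in
  argmin (dotv v) X s -> dotv v (t - x) <= delta * dotv v (s - x) ->
  x' = x + eta *: (t - x) ->
  fine (f x') - fine (f xs) + eucl_dist (A *m x') K ^+ 2 / (2 * beta) <=
  (1 - delta * eta)
    * (fine (f x) - fine (f xs) + eucl_dist (A *m x) K ^+ 2 / (2 * beta))
  - delta * eta * (eucl_dist (A *m x) K ^+ 2 / (2 * beta))
  + eta ^+ 2 / 2
    * (eucl_diam X ^+ 2 * L + (specnorm A * eucl_diam X) ^+ 2 / beta).
Proof.
move=> cX cvX cf fNy fd fL clK cK b0 d0 eta0 eta1 Xx Xt Xxs Kxs v [Xs smin] tmul.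
move=> x'E; pose dist z := eucl_dist (A *m z) K; set D := eucl_diam X.
rewrite -/(dist x) -/(dist x').
have ffin z : X z -> f z \is a fin_num by move=> /fd[/nbhs_singleton].
have fdiff z : X z -> differentiable (fine \o f) z by move=> /fd[].
have Xx' : X x' by rewrite x'E; exact: convex_segment.
have [Kp pmin] := prox_indicator K beta (A *m x) clK (ex_intro _ _ Kxs) b0.
set p := prox _ _ in Kp pmin.
have distx : dist x = eucl_norm (A *m x - p) := dist_nearest K _ p Kp pmin.
set e := A *m x - p in distx.
have dist' : dist x' ^+ 2 <= dist x ^+ 2 + 2 * eta * dotv e (A *m (t - x))
     + eta ^+ 2 * (specnorm A * D) ^+ 2.
  apply: le_trans (_ : eucl_norm (e + eta *: (A *m (t - x))) ^+ 2 <= _).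
    have [Kp' pmin'] := prox_indicator K beta (A *m x') clK (ex_intro _ _ Kxs) b0.
    rewrite /dist (dist_nearest K _ _ Kp' pmin') ler_pXn2r ?nnegrE ?eucl_norm_ge0//.
    have -> : e + eta *: (A *m (t - x)) = A *m x' - p.
      by rewrite scalemxAr /e addrAC -mulmxDr -x'E.
    exact: pmin'.
  rewrite eucl_norm_sq dotv_sqDZ distx eucl_norm_sq lerD2l ler_wpM2l ?sqr_ge0//.
  rewrite -eucl_norm_sq ler_pXn2r ?nnegrE ?eucl_norm_ge0//.
    apply: le_trans (le_specnorm A _) _.
    by rewrite ler_wpM2l ?specnorm_ge0// le_eucl_diam.
  rewrite mulr_ge0 ?specnorm_ge0//.
  exact: le_trans (eucl_norm_ge0 _) (le_eucl_diam X x x cX Xx Xx).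
have f' : fine (f x') <= fine (f x) + eta * dotv (grad f x) (t - x)
     + eta ^+ 2 / 2 * (D ^+ 2 * L).
  apply: le_trans (descent_lemma f L X x x' cvX fdiff fL Xx Xx') _.
  have -> : x' - x = eta *: (t - x) by rewrite x'E addrC addKr.
  rewrite dotvZr eucl_normZ exprMn real_normK ?num_real//.
  have := ler_wpM2l (sqr_ge0 eta) (smooth_diam f L X t x cX fL Xt Xx).
  rewrite -/D; lra.
have xs_grad := convex_gradient f x xs cf (fdiff _ Xx) fNy (ffin _ Xx) (ffin _ Xxs).
have xs_proj := nearest_obtuse K (A *m x) p (A *m xs) cK Kp pmin Kxs.
have xs_dir : dotv v (xs - x) <= beta * (fine (f xs) - fine (f x)) - dist x ^+ 2.
  rewrite dotv_direction -/p -/e mulmxBr.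
  have -> : A *m xs - A *m x = (A *m xs - p) - e by rewrite /e opprB addrA subrK.
  rewrite (dotvBr e) distx eucl_norm_sq.
  have := ler_wpM2l (ltW b0) xs_grad; move: xs_proj; rewrite -/e; lra.
have dir : dotv v (t - x) <= delta * (beta * (fine (f xs) - fine (f x)) - dist x ^+ 2).
  apply: le_trans tmul _; rewrite ler_wpM2l ?(ltW d0)//; apply: le_trans xs_dir.
  by rewrite !dotvBr lerD2r smin.
move: dir; rewrite dotv_direction -/p -/e => dir.
have dir' := ler_wpM2l eta0 dir.
rewrite -(ler_pM2l b0).
have -> : beta * (fine (f x') - fine (f xs) + dist x' ^+ 2 / (2 * beta))
   = beta * (fine (f x') - fine (f xs)) + dist x' ^+ 2 / 2 by field; rewrite gt_eqF.
have -> : beta * ((1 - delta * eta) * (fine (f x) - fine (f xs)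
      + dist x ^+ 2 / (2 * beta)) - delta * eta * (dist x ^+ 2 / (2 * beta))
      + eta ^+ 2 / 2 * (D ^+ 2 * L + (specnorm A * D) ^+ 2 / beta))
   = (1 - delta * eta) * (beta * (fine (f x) - fine (f xs)) + dist x ^+ 2 / 2)
     - delta * eta * (dist x ^+ 2 / 2)
     + eta ^+ 2 / 2 * (beta * (D ^+ 2 * L) + (specnorm A * D) ^+ 2).
  by field; rewrite gt_eqF.
have := ler_wpM2l (ltW b0) f'.
move: dist' dir'.
move: (dotv e _) (dotv (grad f x) _) (fine (f x')) (fine (f x)) (fine (f xs))
  (dist x') (dist x) (specnorm A) => *.
lra.
Qed.

(** By induction, [smoothing_step] absorbing the change of the smoothing parameter.
    The distance at [x j.+1] is weighted by the parameter
    [beta0 / sqrt (delta * j + 1)] of the step that produced this point; for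
    [j = 0] the distance vanishes. *)
Lemma gap_rate {R : realType} {n d} (f : 'cV[R]_n -> \bar R)
    (L : R) (X : set 'cV[R]_n) (A : 'M[R]_(d, n)) (K : set 'cV[R]_d)
    (beta0 delta : R) (x s t : nat -> 'cV[R]_n) (xs : 'cV[R]_n) :
  compact X -> @convex_set R 'cV[R]_n X -> econvex f -> (forall z, -oo < f z)%E ->
  (forall z, X z -> edifferentiable f z) -> smooth_on L X f ->
  closed K -> @convex_set R 'cV[R]_d K ->
  0 < beta0 -> 0 < delta -> delta <= 1 -> X xs -> K (A *m xs) ->
  cg_multiplicative f (indicator K) A X beta0 delta x s t ->
  K (A *m x 1%N) -> fine (f xs) <= fine (f (x 1%N)) ->
  let P := eucl_diam X ^+ 2 * L + delta * (fine (f (x 1%N)) - fine (f xs)) in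
  forall j, X (x j.+1) /\
    fine (f (x j.+1)) - fine (f xs)
      + eucl_dist (A *m x j.+1) K ^+ 2 * Num.sqrt (delta * j%:R + 1) / (2 * beta0)
    <= rate delta P ((specnorm A * eucl_diam X) ^+ 2 / beta0) (delta * j%:R + 2).
Proof.
move=> cX cvX cf fNy fd fL clK cK b0 d0 d1 Xxs Kxs [X1 alg] Kx1 x1min P.
set M := eucl_diam X ^+ 2 * L in P *.
set N := (specnorm A * eucl_diam X) ^+ 2 / beta0.
have M0 : 0 <= M.
  have := smooth_diam f L X xs xs cX fL Xxs Xxs.
  by rewrite subrr eucl_norm0 expr0n mulr0.
have MP : M <= P by rewrite lerDl mulr_ge0 ?subr_ge0// ltW.
have P0 := le_trans M0 MP.
have N0 : 0 <= N by rewrite divr_ge0 ?sqr_ge0 ?ltW.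
elim=> [|j [Xj IH]].
  split=> //.
  have [Kp pmin] := prox_indicator K 1 (A *m x 1%N) clK (ex_intro _ _ Kxs) ltr01.
  have -> : eucl_dist (A *m x 1%N) K = 0.
    apply/eqP; rewrite eq_le (dist_nearest K _ _ Kp pmin) eucl_norm_ge0 andbT.
    by apply: le_trans (pmin _ Kx1) _; rewrite subrr eucl_norm0.
  rewrite expr0n !mul0r addr0 mulr0 add0r /rate.
  have -> : 2 * P / (delta * 2) = M / delta + (fine (f (x 1%N)) - fine (f xs)).
    by rewrite /P; field; rewrite gt_eqF.
  have : 0 <= M / delta by rewrite divr_ge0// ltW.
  have : 0 <= 4 * N / (3 * delta * Num.sqrt 2).
    apply: divr_ge0; first exact: mulr_ge0.
    by apply: mulr_ge0; [apply: mulr_ge0; [|exact: ltW]|exact: sqrtr_ge0].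
  lra.
have [smin Xt tmul xE] := alg j.+1 isT.
have j1 : j.+1%:R = j%:R + 1 :> R by rewrite -natr1.
have j0 : 0 <= j%:R :> R by [].
have dj0 : 0 <= delta * j%:R by rewrite mulr_ge0// ltW.
set w := delta * j%:R + 2 in IH *.
pose u := delta * j.+1%:R + 1.
have uE : u = w + delta - 1 by rewrite /u /w j1; ring.
have w2 : 2 <= w by rewrite /w; lra.
have w0 : 0 < w by lra.
have etaE : eta_ delta j.+1 = 2 / w by rewrite /eta_ /w j1 addrK.
have eta0 : 0 <= 2 / w by rewrite divr_ge0 ?(ltW w0).
have eta1 : 2 / w <= 1 by rewrite ler_pdivrMr// mul1r.
have r0 : 0 < Num.sqrt u by rewrite sqrtr_gt0; lra.
have rE : Num.sqrt u ^+ 2 = u by rewrite sqr_sqrtr; lra.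
have q0 : 0 <= Num.sqrt (delta * j%:R + 1) by exact: sqrtr_ge0.
have qE : Num.sqrt (delta * j%:R + 1) ^+ 2 = u - delta.
  by rewrite sqr_sqrtr /u ?j1; [ring|lra].
have betaE : beta_ beta0 delta j.+1 = beta0 / Num.sqrt u by [].
have beta0' : 0 < beta0 / Num.sqrt u by rewrite divr_gt0.
have rm : Num.sqrt u <= Num.sqrt w by apply: ler_wsqrtr; lra.
rewrite -/u etaE in xE *; rewrite betaE in smin tmul.
split; first by rewrite xE; exact: convex_segment.
have := smoothed_descent f L X A K (beta0 / Num.sqrt u) delta (2 / w) (x j.+1)
  (s j.+1) (t j.+1) (x j.+2) xs cX cvX cf fNy fd fL clK cK beta0' d0 eta0 eta1
  Xj Xt Xxs Kxs smin tmul xE.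
have -> : delta * j.+1%:R + 2 = w + delta by rewrite /w j1; ring.
have := rate_step delta P N M w (Num.sqrt u) d0 d1 w2 N0 MP P0 rm.
have u1 : 1 + delta <= u by lra.
have := smoothing_step delta u _ _ d0 d1 u1 (ltW r0) q0 rE qE.
have -> : (specnorm A * eucl_diam X) ^+ 2 / (beta0 / Num.sqrt u) = N * Num.sqrt u.
  by rewrite /N invf_div mulrA mulrAC.
rewrite -/M.
have dE (e : R) : e / (2 * (beta0 / Num.sqrt u)) = e * Num.sqrt u / (2 * beta0).
  by rewrite mulrA invf_div mulrA.
rewrite !dE => step rstep descent; apply: le_trans descent _; apply: le_trans rstep.
rewrite lerD2r.
have c0 : 0 <= 1 - delta * (2 / w).
  rewrite subr_ge0; apply: le_trans (_ : 1 * 1 <= _); last by rewrite mul1r.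
  by apply: ler_pM => //; exact: ltW.
apply: le_trans (ler_wpM2l c0 IH).
set D2 := eucl_dist (A *m x j.+1) K ^+ 2.
have D20 : 0 <= D2 by exact: sqr_ge0.
have step' : (1 - delta * (2 / w) - delta * (2 / w)) * Num.sqrt u
    <= (1 - delta * (2 / w)) * Num.sqrt (delta * j%:R + 1).
  rewrite -(ler_pM2l w0); apply: le_trans (le_trans _ step) _; rewrite uE le_eqVlt;
    apply/orP; left; apply/eqP; field; exact: lt0r_neq0.
have b2 : 0 < 2 * beta0 by rewrite mulr_gt0.
have := ler_wpM2l (divr_ge0 D20 (ltW b2)) step'.
lra.
Qed.

(** * Duality *)

(** Off [K] the dual variable can be sent to infinity along the normal to [K] at
    the projection of [A x]; on [K] the choice [y = 0] gives [f x]. Hence the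
    inner supremum dominates the objective. Stating this for real minorants [r]
    covers the case of an infinite optimal value. *)
Lemma objective_le_dual {R : realType} {n d} (f : 'cV[R]_n -> \bar R)
    (X : set 'cV[R]_n) (A : 'M[R]_(d, n)) (K : set 'cV[R]_d) ystar (r : R) :
  (forall z, X z -> f z \is a fin_num) ->
  closed K -> @convex_set R 'cV[R]_d K -> K !=set0 ->
  strong_duality f (indicator K) A X -> dual_solution f (indicator K) A X ystar ->
  (forall z, X z -> r%:E <= objective f (indicator K) A z)%E ->
  (r%:E <= dual_fun f (indicator K) A X ystar)%E.
Proof.
move=> ffin clK cK K0 duality dual rle.
apply: le_trans (_ : ereal_sup [set dual_fun f (indicator K) A X y | y in setT]
  <= _)%E; last by apply: ge_ereal_sup => _ [y _ <-].
rewrite duality; apply: le_ereal_inf_tmp => _ [z Xz <-].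
have conj_le (y : 'cV[R]_d) c : (forall w, K w -> dotv y w <= c) ->
    (fenchel_conjugate (indicator K) y <= c%:E)%E.
  move=> h; apply: ge_ereal_sup => _ [w _ <-]; rewrite /indicator.
  have [/set_mem Kw|_] := boolP (w \in K); first by rewrite sube0 lee_fin h.
  by rewrite addeNy leNye.
suff [y [c [yc rc]]] : exists y c, (forall w, K w -> dotv y w <= c)
    /\ r <= fine (f z) + dotv y (A *m z) - c.
  apply: le_ereal_sup_tmp; exists (lagrangian f (indicator K) A z y); first by exists y.
  rewrite /lagrangian -(fineK (ffin _ Xz)) -EFinD.
  apply: le_trans (_ : (fine (f z) + dotv y (A *m z))%:E - c%:E <= _)%E.
    by rewrite -EFinB lee_fin.
  by apply: leeB => //; exact: conj_le.
have [Kz|Kz] := pselect (K (A *m z)).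
  exists 0, 0; rewrite -(scale0r 0) dotvZl mul0r addr0 subr0.
  split=> [w _|]; first by rewrite dotvZl mul0r.
  have := rle z Xz; rewrite /objective /indicator mem_set// adde0.
  by rewrite -{1}(fineK (ffin _ Xz)) lee_fin.
have [q Kq qmin] := exists_nearest K (A *m z) clK K0.
set e := A *m z - q in qmin.
have e0 : 0 < dotv e e.
  rewrite lt0r dotvv_ge0 andbT; apply/eqP => /dotvv_eq0 /eqP.
  by rewrite subr_eq0 => /eqP zq; apply: Kz; rewrite zq.
pose a := `|r - fine (f z)| / dotv e e.
have a0 : 0 <= a by rewrite divr_ge0// ltW.
exists (a *: e), (a * dotv e q); split=> [w Kw|].
  rewrite dotvZl ler_wpM2l// -subr_le0 -dotvBr.
  exact: nearest_obtuse cK Kq qmin Kw.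
rewrite dotvZl -addrA -mulrBr -dotvBr -/e divfK ?gt_eqF//.
by have := ler_norm (r - fine (f z)); lra.
Qed.

(** In the conjugate of the indicator, the point [p] gives a lower bound. *)
Lemma dual_fun_le {R : realType} {n d} (f : 'cV[R]_n -> \bar R)
    (X : set 'cV[R]_n) (A : 'M[R]_(d, n)) (K : set 'cV[R]_d) y z p :
  X z -> f z \is a fin_num -> K p ->
  (dual_fun f (indicator K) A X y <= (fine (f z) + dotv y (A *m z - p))%:E)%E.
Proof.
move=> Xz fz Kp.
apply: le_trans (_ : lagrangian f (indicator K) A z y <= _)%E.
  by apply: ereal_inf_lbound; exists z.
rewrite /lagrangian -{1}(fineK fz) dotvBr addrA EFinD EFinN EFinD.
apply: leeB => //; apply: ereal_sup_ubound; exists p => //.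
by rewrite /indicator mem_set// sube0.
Qed.

(** * Convergence rates *)

Theorem theorem4p6 (R : realType) (n d : nat)
  (X : set 'cV[R]_n) (f : 'cV[R]_n -> \bar R) (Lf : R)
  (A : 'M[R]_(d, n)) (g : 'cV[R]_d -> \bar R) (K : set 'cV[R]_d)
  (xstar : 'cV[R]_n) (ystar : 'cV[R]_d) (beta0 delta : R)
  (x s stilde : nat -> 'cV[R]_n)
  (X_neq0 : X !=set0) (X_compact : compact X)
  (X_convex : @convex_set R 'cV[R]_n X)
  (f_pcc : proper_closed_convex f)
  (f_diff : forall z, X z -> edifferentiable f z)
  (f_smooth : smooth_on Lf X f)
  (g_pcc : proper_closed_convex g)
  (K_convex : @convex_set R 'cV[R]_d K)
  (g_indic : g = indicator K)
  (xstar_min : argmin (objective f g A) X xstar)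
  (duality : strong_duality f g A X)
  (ystar_dual : dual_solution f g A X ystar)
  (beta0_gt0 : 0 < beta0) (delta_gt0 : 0 < delta) (delta_le1 : delta <= 1)
  (algorithm : cg_multiplicative f g A X beta0 delta x s stilde) :
  let D := eucl_diam X in
  let C0 := Lf + specnorm A ^+ 2 / beta0 in
  let E := (objective f g A (x 1%N) - objective f g A xstar)%E in
  forall k : nat, (1 <= k)%N ->
  [/\ (f (x k) - f xstar >= (- eucl_norm ystar * eucl_dist (A *m x k) K)%R%:E)%E,
      (f (x k) - f xstar <=
         (2 / delta)%R%:E *
         (((D ^+ 2 * Lf)%R%:E + delta%:E * E) / (delta * k%:R + 1)%R%:E
          + (D ^+ 2 * specnorm A ^+ 2
             / (beta0 * Num.sqrt (delta * k%:R + 1)))%R%:E))%E &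
      ((eucl_dist (A *m x k) K)%:E <=
         (2 * beta0 / Num.sqrt (delta * k%:R + 1))%R%:E *
         ((eucl_norm ystar)%:E
          + sqrte (((D ^+ 2 * C0)%R%:E + delta%:E * E)
                   / (beta0 * delta)%R%:E)))%E].
Proof.
move=> D C0 E k k1.
have [[fNy _] _ f_conv] := f_pcc.
have ffin z : X z -> f z \is a fin_num by move=> /f_diff[/nbhs_singleton].
rewrite {}g_indic in g_pcc xstar_min duality ystar_dual algorithm E *.
have [[_ [z0 gz0]] /indicator_closed K_closed _] := g_pcc.
have K_neq0 : K !=set0.
  by exists z0; move: gz0; rewrite /indicator; case: ifPn => // /set_mem.
have [Xxs xs_le] := xstar_min.
have objK z : K (A *m z) -> objective f (indicator K) A z = f z.
  by move=> Kz; rewrite /objective /indicator mem_set// adde0.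
have objN z : X z -> ~ K (A *m z) -> objective f (indicator K) A z = +oo%E.
  by move=> /ffin fz Kz; rewrite /objective /indicator memNset// -(fineK fz).
(* an infeasible minimizer would make the dual value infinite, whereas a point
   of [K] bounds it by the real number [c] *)
have Kxs : K (A *m xstar).
  apply: contrapT => nK; have [p Kp] := K_neq0.
  have up := dual_fun_le f X A K ystar xstar p Xxs (ffin _ Xxs) Kp.
  set c := _ + _ in up.
  have := objective_le_dual f X A K ystar (c + 1) ffin K_closed K_convex K_neq0
    duality ystar_dual.
  have rle z : X z -> ((c + 1)%:E <= objective f (indicator K) A z)%E.
    by move=> /xs_le; rewrite (objN _ Xxs nK) leye_eq => /eqP ->; rewrite leey.
  by move=> /(_ rle) /le_trans /(_ up); rewrite lee_fin; lra.
have Fxs : objective f (indicator K) A xstar = (fine (f xstar))%:E.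
  by rewrite objK// fineK// ffin.
have xs_dual : ((fine (f xstar))%:E <= dual_fun f (indicator K) A X ystar)%E.
  by apply: objective_le_dual => // z Xz; rewrite -Fxs xs_le.
have Xx j : X (x j.+1).
  elim: j => [|j IH]; first by case: algorithm.
  have [_ Xt _ ->] := algorithm.2 j.+1 isT.
  have w2 : 2 <= delta * (j.+1%:R - 1) + 2.
    by rewrite -(natr1 j) addrK lerDr mulr_ge0// ltW.
  have w0 : 0 < delta * (j.+1%:R - 1) + 2 by lra.
  apply: convex_segment => //; rewrite /eta_; first by rewrite divr_ge0// ltW.
  by rewrite ler_pdivrMr// mul1r.
case: k k1 => // j _.
have [Kp pmin] := prox_indicator K 1 (A *m x j.+1) K_closed K_neq0 ltr01.
set p := prox _ _ in Kp pmin.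
have distE : eucl_dist (A *m x j.+1) K = eucl_norm (A *m x j.+1 - p).
  exact: dist_nearest.
have lower : - eucl_norm ystar * eucl_dist (A *m x j.+1) K
    <= fine (f (x j.+1)) - fine (f xstar).
  have := le_trans xs_dual
    (dual_fun_le f X A K ystar (x j.+1) p (Xx j) (ffin _ (Xx j)) Kp).
  rewrite lee_fin distE; have := cauchy_schwarz ystar (A *m x j.+1 - p); lra.
have fE : (f (x j.+1) - f xstar)%E = (fine (f (x j.+1)) - fine (f xstar))%:E.
  by rewrite EFinB !fineK ?ffin.
set u := delta * j.+1%:R + 1.
have dj0 : 0 <= delta * j%:R by rewrite mulr_ge0// ltW.
have uE : u = delta * j%:R + 1 + delta by rewrite /u -(natr1 j); ring.
have u0 : 0 < u by lra.
have ru0 : 0 < Num.sqrt u by rewrite sqrtr_gt0.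
have bd0 : 0 < beta0 * delta by rewrite mulr_gt0.
have ru2 : Num.sqrt u ^+ 2 = u by rewrite sqr_sqrtr ?(ltW u0).
have [Kx1|nKx1] := pselect (K (A *m x 1%N)); last first.
  (* the initial gap is infinite, and so are both upper bounds *)
  have EE : E = +oo%E by rewrite /E (objN _ (Xx 0%N) nKx1) Fxs.
  have dE : (delta%:E * E = +oo)%E by rewrite EE gt0_muley ?lte_fin.
  have addy (r : R) : (r%:E + +oo = +oo)%E by [].
  have divy (r : R) : 0 < r -> (+oo / r%:E = +oo)%E.
    by move=> r0; rewrite inver gt_eqF// gt0_mulye ?lte_fin ?invr_gt0.
  split; first by rewrite fE lee_fin.
    by rewrite dE addy divy// addye// gt0_muley ?lte_fin ?divr_gt0// leey.
  rewrite dE addy divy//= addy gt0_muley ?leey// lte_fin divr_gt0//.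
  by rewrite mulr_gt0.
have x1fin := ffin _ (Xx 0%N).
have x1min : fine (f xstar) <= fine (f (x 1%N)).
  by have := xs_le _ (Xx 0%N); rewrite Fxs objK// -(fineK x1fin) lee_fin.
have EE : E = (fine (f (x 1%N)) - fine (f xstar))%:E.
  by rewrite /E Fxs objK// EFinB (fineK x1fin).
set e1 := fine (f (x 1%N)) - fine (f xstar) in EE.
have [_ bound] := gap_rate f Lf X A K beta0 delta x s stilde xstar X_compact X_convex
  f_conv fNy f_diff f_smooth K_closed K_convex beta0_gt0 delta_gt0 delta_le1 Xxs Kxs
  algorithm Kx1 x1min j.
rewrite -/e1 -/D in bound.
set P := D ^+ 2 * Lf + delta * e1 in bound.
set G := specnorm A * D in bound.
have P0 : 0 <= P.
  apply: addr_ge0; last by rewrite mulr_ge0 ?(ltW delta_gt0) ?subr_ge0.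
  have := smooth_diam f Lf X xstar xstar X_compact f_smooth Xxs Xxs.
  by rewrite subrr eucl_norm0 expr0n mulr0.
have N0 : 0 <= G ^+ 2 / beta0 by rewrite divr_ge0 ?sqr_ge0// ltW.
have uw : u <= delta * j%:R + 2 by lra.
have PE : ((D ^+ 2 * Lf)%:E + delta%:E * E)%E = P%:E by rewrite EE -EFinM -EFinD.
have [dist0 dist_le] : 0 <= eucl_dist (A *m x j.+1) K
    /\ eucl_dist (A *m x j.+1) K <= G.
  rewrite distE eucl_norm_ge0; split=> //; apply: le_trans (pmin _ Kxs) _.
  rewrite -mulmxBr; apply: le_trans (le_specnorm A _) _.
  by rewrite ler_wpM2l ?specnorm_ge0// le_eucl_diam.
split; first by rewrite fE lee_fin.
- rewrite fE PE inver gt_eqF// -(EFinM P) -(EFinD (P / u)) -EFinM lee_fin.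
  have gap_le : fine (f (x j.+1)) - fine (f xstar)
      <= rate delta P (G ^+ 2 / beta0) (delta * j%:R + 2).
    apply: le_trans bound; rewrite lerDl divr_ge0 ?mulr_ge0 ?sqr_ge0 ?sqrtr_ge0//.
    by rewrite (ltW beta0_gt0).
  apply: le_trans gap_le (le_trans (rate_anti delta P _ u _ delta_gt0 u0 uw P0 N0) _).
  rewrite le_eqVlt; apply/orP; left; apply/eqP; rewrite /G exprMn.
  by field; rewrite ?gt_eqF.
- have C0E : ((D ^+ 2 * C0)%:E + delta%:E * E)%E = (P + G ^+ 2 / beta0)%:E.
    rewrite EE -EFinM -EFinD /P /G /C0; congr EFin.
    by field; rewrite gt_eqF.
  rewrite C0E inver gt_eqF// -(EFinM (P + _)) /= -(EFinD (eucl_norm ystar)) -EFinM.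
  rewrite lee_fin.
  have u1 : 1 + delta <= u by lra.
  have w2 : 2 <= delta * j%:R + 2 by lra.
  apply: (feasibility_bound beta0 delta u (delta * j%:R + 2)
    (Num.sqrt (delta * j%:R + 1)) _ (eucl_norm ystar) G P
    (fine (f (x j.+1)) - fine (f xstar))) => //.
  - by rewrite sqr_sqrtr; lra.
  - exact: eucl_norm_ge0.
  - by rewrite sqr_sqrtr// divr_ge0 ?(ltW bd0)// addr_ge0.
Qed.
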